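(* Let $X$ be an irreducible discrete-time Markov chain on a finite state space $\mathcal{X}$, and let $\mu,\nu$ be probability distributions on $\mathcal{X}$. Then the optimal transport time $H(\mu,\nu)$ from $\mu$ to $\nu$ using $X$ satisfies $$H(\mu,\nu) \leq \max_{i,j \in \mathcal{X}} \mathbb{E}_i[\tau_j].$$
   Context: For a state $j$, $\tau_j := \inf\{t \geq 0 : X_t = j\}$ is the hitting time of $j$, and $\mathbb{E}_i$ denotes expectation when $X_0 = i$. For probability distributions $\mu,\nu$ on the state space, the optimal transport time (also called access time) is $H(\mu,\nu) := \inf_{T} \mathbb{E}[T]$, where $X_0 \sim \mu$ and the infimum is over all almost surely finite, possibly randomized, stopping times $T$ of $X$ such that $X_T \sim \nu$. (A randomized stopping time is a stopping time with respect to a filtration $\mathcal{F}_t = \sigma(U, X_0,\dots,X_t)$, where $U$ is uniform on $[0,1]$ and independent of $X$.) *)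

(* Defs.v *)
From HB Require Import structures.
From mathcomp Require Import all_boot all_order all_algebra.
From mathcomp Require Import all_classical all_reals all_analysis.
Import Order.TTheory GRing.Theory Num.Theory.

Set Implicit Arguments.
Unset Strict Implicit.
Unset Printing Implicit Defensive.

Local Open Scope classical_set_scope.
Local Open Scope ring_scope.

Record distr (R : realType) (S : finType) := Distr {
  pmf :> S -> R;
  pmf_ge0 : forall x, 0 <= pmf x;
  pmf_sum1 : \sum_x pmf x = 1 }.

Lemma point_mass_ge0 (R : realType) (S : finType) (i x : S) :
  0 <= (x == i)%:R :> R.
Proof. exact: ler0n. Qed.

Lemma point_mass_sum1 (R : realType) (S : finType) (i : S) :
  \sum_(x : S) (x == i)%:R = 1 :> R.
Proof.
by rewrite (bigD1 i)//= eqxx big1 ?addr0// => j /negbTE ->.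
Qed.

Definition point_mass (R : realType) (S : finType) (i : S) : distr R S :=
  Distr (point_mass_ge0 R i) (point_mass_sum1 R i).

(* A transition matrix is a map p : S -> distr R S, with p i j the probability
   of a jump from i to j. *)
Fixpoint nstep (R : realType) (S : finType) (p : S -> distr R S) (n : nat)
    (i j : S) : R :=
  if n is m.+1 then \sum_k p i k * nstep p m k j else (i == j)%:R.

Definition irreducible_chain (R : realType) (S : finType)
    (p : S -> distr R S) : Prop :=
  forall i j, exists n, 0 < nstep p n i j.

Definition cond_prob d (Omega : measurableType d) (R : realType)
    (P : probability Omega R) (A B : set Omega) : R :=
  fine (P (A `&` B)) / fine (P B).

Definition history (Omega : Type) (S : finType) (X : nat -> Omega -> S)
    (t : nat) (x : nat -> S) : set Omega :=
  [set w | forall k, (k <= t)%N -> X k w = x k].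

(* Measurability of X t is with respect to the discrete sigma-algebra on S. *)
Definition markov_chain d (Omega : measurableType d) (R : realType)
    (S : finType) (p : S -> distr R S) (lambda : distr R S)
    (P : probability Omega R) (X : nat -> Omega -> S) : Prop :=
  [/\ forall t (s : S), measurable (X t @^-1` [set s]),
      forall s : S, P (X 0%N @^-1` [set s]) = (lambda s)%:E &
      forall t (x : nat -> S) (y : S), P (history X t x) != 0%E ->
        cond_prob P (X t.+1 @^-1` [set y]) (history X t x) = p (x t) y].

Definition sigma_X (Omega : Type) (S : finType) (X : nat -> Omega -> S) :
    set (set Omega) :=
  <<s \bigcup_k preimage_set_system setT (X k) setT >>.

Definition filtration d (Omega : measurableType d) (R : realType) (S : finType)
    (U : Omega -> R) (X : nat -> Omega -> S) (t : nat) : set (set Omega) :=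
  <<s preimage_set_system setT U measurable `|`
      \bigcup_(k in [set k | (k <= t)%N])
        preimage_set_system setT (X k) setT >>.

Definition uniform_independent d (Omega : measurableType d) (R : realType)
    (S : finType) (P : probability Omega R) (U : Omega -> R)
    (X : nat -> Omega -> S) : Prop :=
  [/\ measurable_fun setT U,
      forall B, measurable B -> P (U @^-1` B) = uniform_prob (@ltr01 R) B &
      forall B A, measurable B -> sigma_X X A ->
        P ((U @^-1` B) `&` A) = (P (U @^-1` B) * P A)%E].

(* Random times are \bar R-valued, so that they can be integrated; a stopping
   time is required to take its values in {0, 1, 2, ...} or +oo. *)
Definition randomized_stopping_time d (Omega : measurableType d)
    (R : realType) (S : finType) (U : Omega -> R) (X : nat -> Omega -> S)
    (T : Omega -> \bar R) : Prop :=
  (forall w, T w = +oo%E \/ exists n : nat, T w = (n%:R)%:E) /\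
  (forall t : nat, filtration U X t [set w | (T w <= (t%:R)%:E)%E]).

(* X_T ~ nu, where X_T is only defined on {T < +oo}. *)
Definition stopped_law d (Omega : measurableType d) (R : realType)
    (S : finType) (P : probability Omega R) (X : nat -> Omega -> S)
    (T : Omega -> \bar R) (nu : distr R S) : Prop :=
  forall s : S,
    P [set w | exists2 n : nat, T w = (n%:R)%:E & X n w = s] = (nu s)%:E.

Definition optimal_transport_time d (Omega : measurableType d) (R : realType)
    (S : finType) (Pr : distr R S -> probability Omega R) (U : Omega -> R)
    (X : nat -> Omega -> S) (mu nu : distr R S) : \bar R :=
  ereal_inf [set (\int[Pr mu]_w T w)%E | T in
    [set T | [/\ randomized_stopping_time U X T,
                 {ae Pr mu, forall w, (T w < +oo)%E} &
                 stopped_law (Pr mu) X T nu]]].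

(* The infimum of the empty set is +oo. *)
Definition hitting_time (Omega : Type) (R : realType) (S : finType)
    (X : nat -> Omega -> S) (j : S) (w : Omega) : \bar R :=
  ereal_inf [set (t%:R)%:E | t in [set t : nat | X t w = j]].

Definition mean_hitting_time d (Omega : measurableType d) (R : realType)
    (S : finType) (Pr : distr R S -> probability Omega R)
    (X : nat -> Omega -> S) (i j : S) : \bar R :=
  (\int[Pr (point_mass R i)]_w hitting_time R X j w)%E.

(* Main.v *)
Require Import Defs.
From HB Require Import structures.
From mathcomp Require Import all_boot all_order all_algebra.
From mathcomp Require Import all_classical all_reals all_analysis.
From mathcomp Require Import measurable_realfun.
Import Order.TTheory GRing.Theory Num.Theory.

Set Implicit Arguments.
Unset Strict Implicit.
Unset Printing Implicit Defensive.

Local Open Scope classical_set_scope.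
Local Open Scope ring_scope.

(** The idea is to choose a target [J] of law [nu] from the auxiliary uniform
    variable, independently of the chain, and to stop the chain when it hits
    [J]. Concretely, [0, 1) is cut into disjoint intervals [B j] of length
    [nu j] ([uniform_partition]) and [T] is the first time [t] at which [U]
    lies in [B (X t)]; on the event that [U] lies in [B j] this is the hitting
    time of [j].

    The time [T] is a randomized stopping time, because [T <= t] is decided by
    [U] and [X 0, ..., X t], and [X] equals [J] at time [T] whenever [T] is
    finite. Its mean is the average of hitting times
    [E T = \sum_j nu j \sum_i mu i E_i(tau_j)], which is at most their maximum
    ([mean_randomized_hitting_time]). If that maximum is infinite there is
    nothing to prove; otherwise [T] has a finite mean, so that it is almost
    surely finite and [X_T] has law [nu]
    ([stopped_law_randomized_hitting_time]).

    The formula for the mean is obtained from the tail sum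
    [E T = \sum_t P(T > t)] ([mean_entry_time]): each event [T > t] is split
    according to the value of [J], the independence of [U] and [X] gives the
    factor [nu j], and the law of [X 0, ..., X t] under the initial law [mu]
    is the [mu]-mixture of its laws under the point masses
    ([trajectory_mixture]). *)

(** * Entry times of a sequence of events *)

(** Both the hitting time of a state and the stopping time that witnesses the
    bound are of this form. *)
Definition entry_time (R : realType) (Omega : Type) (A : nat -> set Omega)
    (w : Omega) : \bar R :=
  ereal_inf [set (t%:R)%:E | t in [set t : nat | A t w]].

Definition not_entered (Omega : Type) (A : nat -> set Omega) (t : nat) :
    set Omega :=
  [set w | forall k, (k <= t)%N -> ~ A k w].

Lemma entry_time_first (R : realType) (Omega : Type) (A : nat -> set Omega)
    w n :
  A n w -> (forall k, (k < n)%N -> ~ A k w) -> entry_time R A w = (n%:R)%:E.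
Proof.
move=> An Ak; apply/le_anti/andP; split.
  by apply: ereal_inf_lbound; exists n.
apply: le_ereal_inf_tmp => _ [k /= Akw <-]; rewrite lee_fin ler_nat leqNgt.
by apply/negP => /Ak.
Qed.

Lemma entry_timeP (R : realType) (Omega : Type) (A : nat -> set Omega) w :
  (exists n, [/\ entry_time R A w = (n%:R)%:E, A n w &
                 forall k, (k < n)%N -> ~ A k w]) \/
  (entry_time R A w = +oo%E /\ forall n, ~ A n w).
Proof.
have [[n0 An0]|noA] := pselect (exists n, A n w); [left|right].
  have ex : exists n, `[< A n w >] by exists n0; apply/asboolP.
  case: (ex_minnP ex) => n /asboolP An minn.
  have lt_n k : (k < n)%N -> ~ A k w.
    by move=> kn /asboolP/minn; rewrite leqNgt kn.
  by exists n; split=> //; exact: entry_time_first.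
have nA n : ~ A n w by move=> An; apply: noA; exists n.
split=> //; rewrite /entry_time (_ : mkset _ = set0) ?image_set0 ?ereal_inf0//.
by apply/seteqP; split=> // n /= /nA.
Qed.

Lemma entry_time_ge0 (R : realType) (Omega : Type) (A : nat -> set Omega) w :
  (0 <= entry_time R A w)%E.
Proof.
by have [[n [-> _ _]]|[-> _]] := entry_timeP R A w; rewrite ?lee_fin// ?leey.
Qed.

Lemma entry_time_leC (R : realType) (Omega : Type) (A : nat -> set Omega) t :
  [set w | (entry_time R A w <= (t%:R)%:E)%E] = ~` not_entered A t.
Proof.
apply/seteqP; split=> w /=; rewrite /not_entered /=.
  have [[n [-> An _]]|[-> nA]] := entry_timeP R A w; last by rewrite leye_eq.
  by rewrite lee_fin ler_nat => nt; move/(_ n nt).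
move=> /existsNP[k /not_implyP[kt /contrapT Ak]].
apply: (@le_trans _ _ (k%:R)%:E); last by rewrite lee_fin ler_nat.
by apply: ereal_inf_lbound; exists k.
Qed.

(** The layer-cake formula: a time valued in the naturals or [+oo] is the number
    of [t] that it exceeds. *)
Lemma entry_time_series (R : realType) (Omega : Type) (A : nat -> set Omega) w :
  entry_time R A w = (\sum_(0 <= t <oo) (\1_(not_entered A t) w)%:E)%E.
Proof.
have [[n [-> An lt_n]]|[-> nA]] := entry_timeP R A w.
  (* The event [not_entered A t] holds exactly for [t < n]. *)
  rewrite (@nneseries_split _ _ 0 n)//.
  rewrite add0n eseries0 ?adde0; last first.
    move=> k nk _; rewrite indicE memNset//= => /(_ n nk); exact.
  rewrite (eq_big_nat _ _ (F2 := fun=> 1%E)); last first.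
    move=> k /andP[_ kn]; rewrite indicE mem_set// => i ik.
    exact/lt_n/(leq_ltn_trans ik).
  by rewrite sumEFin sumr_const_nat subn0.
apply/esym/eqyP => x x0.
have [n xn] : exists n : nat, x <= n%:R.
  by exists (Num.truncn x).+1; exact/ltW/truncnS_gt.
apply: (@le_trans _ _ (n%:R)%:E); first by rewrite lee_fin.
apply: (le_trans _ (nneseries_lim_ge (m := 0) n _)); last first.
  by move=> *; rewrite lee_fin.
rewrite (eq_big_nat _ _ (F2 := fun=> 1%E)); last first.
  by move=> k _; rewrite indicE mem_set.
by rewrite sumEFin sumr_const_nat subn0.
Qed.

Lemma measurable_not_entered d (T : measurableType d) (A : nat -> set T) t :
  (forall k, (k <= t)%N -> measurable (A k)) -> measurable (not_entered A t).
Proof.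
move=> mA.
rewrite (_ : not_entered A t = ~` \bigcup_(k in `I_t.+1) A k).
  by apply: measurableC; apply: fin_bigcup_measurable => // k /= kt; exact: mA.
apply/seteqP; split=> [w nA [k /= kt]|w nA k kt Ak]; first exact: nA.
by apply: nA; exists k.
Qed.

Lemma measurable_entry_time (R : realType) d (T : measurableType d)
    (A : nat -> set T) :
  (forall k, measurable (A k)) -> measurable_fun setT (@entry_time R T A).
Proof.
move=> mA; rewrite (funext (@entry_time_series R T A)).
apply: ge0_emeasurable_sum => [k x _ _|k _]; first by rewrite lee_fin.
by apply/measurable_EFinP/measurable_indic/measurable_not_entered => i _.
Qed.

Lemma mean_entry_time d (T : measurableType d) (R : realType)
    (P : {measure set T -> \bar R}) (A : nat -> set T) :
  (forall k, measurable (A k)) ->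
  (\int[P]_w entry_time R A w = \sum_(0 <= t <oo) P (not_entered A t))%E.
Proof.
move=> mA; have mN t : measurable (not_entered A t).
  by apply: measurable_not_entered.
under eq_integral do rewrite entry_time_series.
rewrite integral_nneseries//=; last first.
  by move=> t; exact/measurable_EFinP/measurable_indic.
by apply: eq_eseriesr => t _; rewrite integral_indic// setIT.
Qed.

(** * Finite decompositions of a measure *)

Lemma measure_bigcup_fin d (T : measurableType d) (R : realType)
    (P : {measure set T -> \bar R}) (I : finType) (Q : {pred I})
    (F : I -> set T) :
  (forall i, measurable (F i)) -> trivIset setT F ->
  P (\bigcup_(i in [set` Q]) F i) = (\sum_(i in Q) P (F i))%E.
Proof.
move=> mF tF; rewrite measure_fin_bigcup//; last exact: sub_trivIset tF.
symmetry; apply: bigfs; first exact: index_enum_uniq.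
by move=> i _; rewrite mem_index_enum.
Qed.

(** Masses summing to 1 make the [F i] exhaust the space up to a null set. The
    lemma is meant for the events that a uniform variable falls in the blocks of
    a partition of [0, 1): some of its values may lie outside all the blocks. *)
Lemma total_probability d (T : measurableType d) (R : realType)
    (P : probability T R) (I : finType) (F : I -> set T) (E : set T) :
  (forall i, measurable (F i)) -> trivIset setT F ->
  (\sum_i P (F i) = 1)%E -> measurable E ->
  P E = (\sum_i P (F i `&` E))%E.
Proof.
move=> mF tF F1 mE; pose V := \bigcup_(i in [set` predT : {pred I}]) F i.
have mV : measurable V by apply: fin_bigcup_measurable => // i _; exact: mF.
have PV : P (~` V) = 0%E.
  rewrite probability_setC// /V measure_bigcup_fin//.
  by rewrite [X in (1 - X)%E](_ : _ = 1%E) ?subee.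
rewrite (measureDI P mE mV) [X in (X + _)%E](_ : _ = 0%E) ?add0e; last first.
  apply: (subset_measure0 _ _ _ PV); first exact: measurableD.
  - exact: measurableC.
  - by rewrite setDE; exact: subIsetr.
rewrite /V setI_bigcupr [LHS](measure_bigcup_fin P); first last.
- by move=> i j _ _ [w [[_ Fi] [_ Fj]]]; apply: tF => //; exists w.
- by move=> i; exact: measurableI.
by apply: eq_bigr => i _; rewrite setIC.
Qed.

(** * Finite-dimensional laws of the chain *)

Section chain.
Variables (R : realType) (S : finType) (p : S -> distr R S).
Variables (d : measure_display) (Omega : measurableType d).
Variable X : nat -> Omega -> S.

Lemma historyS t x :
  history X t.+1 x = (X t.+1 @^-1` [set x t.+1]) `&` history X t x.
Proof.
apply/seteqP; split=> w /=; rewrite /history /=.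
  by move=> h; split=> [|k kt]; apply: h => //; exact: leqW.
by move=> [e h] k; rewrite leq_eqVlt => /predU1P[->//|]; exact: h.
Qed.

Lemma measurable_history t x :
  (forall t (s : S), measurable (X t @^-1` [set s])) ->
  measurable (history X t x).
Proof.
move=> mX; elim: t => [|t IH].
  rewrite (_ : history X 0 x = X 0%N @^-1` [set x 0%N])//.
  apply/seteqP; split=> w /=; first exact.
  by move=> e k; rewrite leqn0 => /eqP ->.
by rewrite historyS; exact: measurableI.
Qed.

(** The conditional probabilities only constrain histories of positive
    probability, but a history extending a null one is null, and so is the
    product. *)
Lemma history_prob (lambda : distr R S) (P : probability Omega R) t x :
  markov_chain p lambda P X ->
  P (history X t x) =
    (lambda (x 0%N) * \prod_(k < t) p (x k) (x k.+1))%:E.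
Proof.
move=> [mX init step]; elim: t => [|t IH].
  rewrite big_ord0 mulr1 -init; congr (P _).
  apply/seteqP; split=> w /=; first exact.
  by move=> e k; rewrite leqn0 => /eqP ->.
have mH n := measurable_history n x mX.
rewrite big_ord_recr /= mulrA.
have [h0|h0] := eqVneq (P (history X t x)) 0%E.
  have -> : lambda (x 0%N) * \prod_(k < t) p (x k) (x k.+1) = 0.
    by apply: EFin_inj; rewrite -IH.
  rewrite mul0r; apply: (subset_measure0 _ _ _ h0) => //.
  by rewrite historyS; exact: subIsetr.
have := step t x (x t.+1) h0; rewrite /cond_prob -historyS IH /=.
move=> /(canRL (mulfVK _)) e.
rewrite -[LHS]fineK ?fin_num_measure// e; first by rewrite mulrC.
by apply: contra_neq h0 => e0; rewrite IH e0.
Qed.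

Definition trajectory t w : {ffun 'I_t.+1 -> S} := [ffun k : 'I_t.+1 => X k w].

Lemma trajectory_prob (lambda : distr R S) (P : probability Omega R) t
    (G : {pred {ffun 'I_t.+1 -> S}}) :
  markov_chain p lambda P X ->
  P [set w | trajectory t w \in G] =
    (\sum_(f in G) lambda (f ord0) *
       \prod_(k < t) p (f (inord k)) (f (inord k.+1)))%:E.
Proof.
move=> mc; have [mX _ _] := mc.
have fibre f :
    [set w | trajectory t w = f] = history X t (fun k => f (inord k)).
  apply/seteqP; split=> w /=; rewrite /history /=.
    by move=> <- k kt; rewrite ffunE inordK.
  by move=> h; apply/ffunP => k; rewrite ffunE (h k) ?inord_val// -ltnS.
rewrite (_ : [set w | _] =
    \bigcup_(f in [set` G]) [set w | trajectory t w = f]).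
  rewrite measure_bigcup_fin; last 2 first.
  - by move=> f; rewrite fibre; exact: measurable_history.
  - by move=> f g _ _ [w /= [<- <-]].
  rewrite -sumEFin; apply: eq_bigr => f _; rewrite fibre.
  rewrite [LHS](history_prob _ _ mc).
  by congr (lambda (f _) * _)%:E; apply/val_inj; rewrite /= inordK.
apply/seteqP; split=> [w /= Gw|w [f /= Gf ->]//].
by exists (trajectory t w).
Qed.

(** The trajectory law is affine in the initial law. *)
Lemma trajectory_mixture (lambda : distr R S) (P : probability Omega R)
    (Q : S -> probability Omega R) t (G : {pred {ffun 'I_t.+1 -> S}}) :
  markov_chain p lambda P X ->
  (forall i, markov_chain p (point_mass R i) (Q i) X) ->
  P [set w | trajectory t w \in G] =
    (\sum_i (lambda i)%:E * Q i [set w | trajectory t w \in G])%E.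
Proof.
move=> mP mQ; rewrite (trajectory_prob _ mP).
have eQ i := trajectory_prob G (mQ i).
under [RHS]eq_bigr => i _ do rewrite eQ -EFinM.
rewrite sumEFin; congr EFin.
under [RHS]eq_bigr do rewrite mulr_sumr.
rewrite exchange_big /=; apply: eq_bigr => f _.
rewrite (bigD1 (f ord0))//= eqxx mul1r [X in _ + X]big1 ?addr0// => i /negbTE.
by rewrite eq_sym => ->; rewrite mul0r mulr0.
Qed.

(** Not having hit [j] by time [t] is a property of the trajectory up to [t]. *)
Lemma not_hit_mixture (lambda : distr R S) (P : probability Omega R)
    (Q : S -> probability Omega R) j t :
  markov_chain p lambda P X ->
  (forall i, markov_chain p (point_mass R i) (Q i) X) ->
  P (not_entered (fun k => X k @^-1` [set j]) t) =
    (\sum_i (lambda i)%:E *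
       Q i (not_entered (fun k => X k @^-1` [set j]) t))%E.
Proof.
move=> mP mQ.
rewrite (_ : not_entered _ t =
  [set w | trajectory t w \in [pred f : {ffun _} | [forall k, f k != j]]]).
  exact: trajectory_mixture.
apply/seteqP; split=> w /=; rewrite inE.
  by move=> nj; apply/forallP => k; rewrite ffunE; apply/eqP/nj; rewrite -ltnS.
move=> /forallP nj k kt.
by have := nj (Ordinal (kt : (k < t.+1)%N)); rewrite ffunE => /eqP.
Qed.

End chain.

(** * Sampling a finite distribution from a uniform variable *)

(** Inverse transform sampling: the blocks are consecutive half-open intervals
    between the partial sums of [nu]. *)
Lemma uniform_partition (R : realType) (S : finType) (nu : distr R S) :
  exists B : S -> set R,
    [/\ forall j, measurable (B j), trivIset setT B &
        forall j, uniform_prob (@ltr01 R) (B j) = (nu j)%:E].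
Proof.
pose c n := \sum_(k : S | (enum_rank k < n)%N) nu k.
have cle m n : (m <= n)%N -> c m <= c n.
  move=> mn; rewrite /c [leRHS](bigID (fun k : S => (enum_rank k < m)%N))/=.
  rewrite [X in _ <= X + _](eq_bigl (fun k : S => (enum_rank k < m)%N)).
    by rewrite lerDl; apply: sumr_ge0 => k _; exact: (Defs.pmf_ge0 nu).
  by move=> k; rewrite andb_idl// => /leq_trans; exact.
have cS (j : S) : c (enum_rank j).+1 = c (enum_rank j) + nu j.
  rewrite /c (bigD1 j)//= addrC; congr (_ + _); apply: eq_bigl => k.
  by rewrite ltnS [RHS]ltn_neqAle andbC (inj_eq val_inj) (inj_eq enum_rank_inj).
have c0 n : 0 <= c n by apply: sumr_ge0 => k _; exact: (Defs.pmf_ge0 nu).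
have c1 n : c n <= 1.
  rewrite -(pmf_sum1 nu) /c [leRHS](bigID (fun k : S => (enum_rank k < n)%N))/=.
  by rewrite lerDl; apply: sumr_ge0 => k _; exact: (Defs.pmf_ge0 nu).
exists (fun j : S => `[c (enum_rank j), c (enum_rank j).+1[%classic); split.
- by move=> j; exact: measurable_itv.
- move=> i j _ _ [x [/=]]; rewrite !in_itv/= => /andP[ix xi] /andP[jx xj].
  apply/enum_rank_inj/val_inj/eqP; rewrite eqn_leq; apply/andP; split.
    rewrite leqNgt; apply/negP => /cle/(lt_le_trans xj).
    by rewrite ltNge ix.
  rewrite leqNgt; apply/negP => /cle/(lt_le_trans xi).
  by rewrite ltNge jx.
- move=> j; rewrite /uniform_prob integral_uniform_pdf setIidl; last first.
    move=> x /=; rewrite !in_itv/= => /andP[cx xc].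
    by rewrite (le_trans (c0 _) cx) (le_trans (ltW xc) (c1 _)).
  rewrite (eq_integral (fun=> 1%E)); last first.
    move=> x /[!inE]/=; rewrite in_itv/= /uniform_pdf => /andP[cx xc].
    by rewrite (le_trans (c0 _) cx) (le_trans (ltW xc) (c1 _)) subr0 invr1.
  rewrite integral_cst//= mul1e lebesgue_measure_itv/= lte_fin cS.
  have := Defs.pmf_ge0 nu j; rewrite le_eqVlt => /predU1P[<-|nu0].
    by rewrite addr0 ltxx.
  by rewrite ltrDl nu0 -EFinB addrAC subrr add0r.
Qed.

(** * The hitting time of a random target *)

(** When the sets [B j] are disjoint and [U w] lies in [B j], this is the
    hitting time of [j]: the block containing [U] encodes the target. Outside
    all the blocks it is [+oo]. *)
Definition randomized_hitting_time (R : realType) (Omega : Type) (S : finType)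
    (X : nat -> Omega -> S) (U : Omega -> R) (B : S -> set R) :
    Omega -> \bar R :=
  entry_time R (fun t => [set w | B (X t w) (U w)]).

Section randomized_hitting_time.
Variables (R : realType) (S : finType).
Variables (d : measure_display) (Omega : measurableType d).
Variables (X : nat -> Omega -> S) (U : Omega -> R) (B : S -> set R).
Hypothesis mB : forall j, measurable (B j).
Hypothesis tB : trivIset setT B.

Let T := randomized_hitting_time X U B.
Let A t := [set w | B (X t w) (U w)].

(** Stated over an arbitrary sigma-algebra, so as to apply to the ambient one
    and to each term of the filtration. *)
Lemma measurable_target_met d' (O : measurableType d')
    (Y : O -> S) (V : O -> R) :
  (forall s, measurable (Y @^-1` [set s])) ->
  (forall j, measurable (V @^-1` B j)) ->
  measurable [set w | B (Y w) (V w)].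
Proof.
move=> mY mV.
rewrite (_ : [set w | _] =
    \bigcup_(j in [set: S]) (Y @^-1` [set j] `&` V @^-1` B j)).
  by apply: fin_bigcup_measurable => // j _; exact: measurableI.
apply/seteqP; split=> [w BY|w [j _ [/= -> ]]//].
by exists (Y w).
Qed.

Lemma randomized_hitting_time_stopping : randomized_stopping_time U X T.
Proof.
split=> [w|t].
  by have [[n [Tn _ _]]|[Ty _]] := entry_timeP R A w; [right; exists n|left].
rewrite [Y in filtration U X t Y]entry_time_leC.
pose G := preimage_set_system setT U measurable `|`
  \bigcup_(k in [set k | (k <= t)%N]) preimage_set_system setT (X k) setT.
apply: (@measurableC _ (g_sigma_algebraType G)).
apply: (@measurable_not_entered _ (g_sigma_algebraType G)) => k kt.
apply: (@measurable_target_met _ (g_sigma_algebraType G)) => [s|j].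
  apply: sub_sigma_algebra; right; exists k => //.
  by exists [set s] => //; rewrite setTI.
by apply: sub_sigma_algebra; left; exists (B j) => //; rewrite setTI.
Qed.

Lemma sigma_X_not_hit j t :
  sigma_X X (not_entered (fun k => X k @^-1` [set j]) t).
Proof.
apply: (@measurable_not_entered _ (g_sigma_algebraType
  (\bigcup_k preimage_set_system setT (X k) setT))) => k _.
apply: sub_sigma_algebra; exists k => //.
by exists [set j] => //; rewrite setTI.
Qed.

Lemma target_eq_not_entered j t :
  U @^-1` B j `&` not_entered A t =
  U @^-1` B j `&` not_entered (fun k => X k @^-1` [set j]) t.
Proof.
apply/seteqP; split=> w [/= Bj nA]; split=> // k kt /= Xk; apply: (nA k kt).
  by rewrite /A /= Xk.
by apply: tB => //; exists (U w).
Qed.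

(** By disjointness of the blocks, the state reached at a finite time [T] is the
    one whose block contains [U]. *)
Lemma stopped_at_target s :
  [set w | exists2 n : nat, T w = (n%:R)%:E & X n w = s] =
  [set w | (T w < +oo)%E] `&` U @^-1` B s.
Proof.
apply/seteqP; split=> w /=; rewrite /T /randomized_hitting_time.
  move=> [n Tn Xn]; rewrite Tn ltry; split=> //.
  have [[m [Tm + _]]|[Ty _]] := entry_timeP R A w; last by rewrite Ty in Tn.
  move: Tm; rewrite Tn => -[/eqP]; rewrite eqr_nat => /eqP <-.
  by rewrite /A /= Xn.
have [[n [-> An _]]|[-> _]] := entry_timeP R A w; last by rewrite ltxx => -[].
by move=> [_ Bs]; exists n => //; apply: tB => //; exists (U w).
Qed.

End randomized_hitting_time.

(** * The mean and the stopped law *)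

Section transport.
Variables (R : realType) (S : finType) (p : S -> distr R S).
Variables (d : measure_display) (Omega : measurableType d).
Variable Pr : distr R S -> probability Omega R.
Variables (X : nat -> Omega -> S) (U : Omega -> R).
Hypothesis chainX : forall lambda, markov_chain p lambda (Pr lambda) X.
Hypothesis unifU : forall lambda, uniform_independent (Pr lambda) U X.
Variables (B : S -> set R) (mu nu : distr R S).
Hypothesis mB : forall j, measurable (B j).
Hypothesis tB : trivIset setT B.
Hypothesis nuB : forall j, uniform_prob (@ltr01 R) (B j) = (nu j)%:E.

Let T := randomized_hitting_time X U B.
Let A t := [set w | B (X t w) (U w)].

Let mX t s : measurable (X t @^-1` [set s]).
Proof. by have [mX _ _] := chainX mu. Qed.

Let mUB j : measurable (U @^-1` B j).
Proof.
by have [mU _ _] := unifU mu; rewrite -(setTI (U @^-1` B j)); exact: mU.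
Qed.

Let mA t : measurable (A t).
Proof. exact: measurable_target_met. Qed.

Let PrUB j : Pr mu (U @^-1` B j) = (nu j)%:E.
Proof.
by have [_ lawU _] := unifU mu; rewrite lawU; [exact: nuB|exact: mB].
Qed.

Let N j t := not_entered (fun k => X k @^-1` [set j]) t.

(** On the event that [U] lies in [B j], the target has not been met by time [t]
    exactly when [j] has not been hit; this last event only depends on the
    chain, hence is independent of [U]. *)
Lemma target_not_met_prob t :
  Pr mu (not_entered A t) =
    (\sum_j \sum_i (nu j * mu i)%:E * Pr (point_mass R i) (N j t))%E.
Proof.
have [_ _ indep] := unifU mu.
rewrite (total_probability (F := fun j => U @^-1` B j))//; first last.
- exact: measurable_not_entered.
- by under eq_bigr do rewrite PrUB; rewrite sumEFin pmf_sum1.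
- by move=> i j _ _ [w [Bi Bj]]; apply: tB => //; exists (U w).
apply: eq_bigr => j _; rewrite target_eq_not_entered// indep//; last first.
  exact: sigma_X_not_hit.
rewrite PrUB (not_hit_mixture _ _ (chainX mu)
  (fun i => chainX (point_mass R i))).
rewrite ge0_sume_distrr; last first.
  by move=> i _; rewrite mule_ge0// lee_fin Defs.pmf_ge0.
by apply: eq_bigr => i _; rewrite muleA -EFinM.
Qed.

Lemma mean_randomized_hitting_time :
  (\int[Pr mu]_w T w =
   \sum_j \sum_i (nu j * mu i)%:E * mean_hitting_time Pr X i j)%E.
Proof.
rewrite [LHS](mean_entry_time (Pr mu) mA).
rewrite [LHS](eq_eseriesr (fun t _ => target_not_met_prob t)).
have c0 i j : (0 <= nu j * mu i) by rewrite mulr_ge0// Defs.pmf_ge0.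
have t0 i j t : (0 <= (nu j * mu i)%:E * Pr (point_mass R i) (N j t))%E.
  by rewrite mule_ge0// lee_fin.
rewrite nneseries_sum; last by move=> j t _; exact: sume_ge0.
apply: eq_bigr => j _; rewrite nneseries_sum//; apply: eq_bigr => i _.
rewrite nneseriesZl//; congr (_ * _)%E.
symmetry; exact: (mean_entry_time _ (fun k => mX k j)).
Qed.

(** A finite mean makes [T] almost surely finite, and then [X_T = s] coincides
    almost surely with [U] lying in [B s]. *)
Lemma stopped_law_randomized_hitting_time :
  (\int[Pr mu]_w T w < +oo)%E ->
  {ae Pr mu, forall w, (T w < +oo)%E} /\ stopped_law (Pr mu) X T nu.
Proof.
move=> ET; have mT : measurable_fun setT T by exact: measurable_entry_time.
have aeT : {ae Pr mu, forall w, (T w < +oo)%E}.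
  have /integrable_ae : (Pr mu).-integrable setT T.
    apply/integrableP; split=> //; under eq_integral => w _.
      rewrite gee0_abs ?entry_time_ge0//; over.
    by [].
  by move=> /(_ measurableT); apply: filterS => w /(_ I); rewrite ltey_eq => ->.
split=> // s; rewrite stopped_at_target// -PrUB.
have mF : measurable [set w | (T w < +oo)%E].
  by rewrite -[X in measurable X]setTI; exact: emeasurable_fun_infty_o.
rewrite [RHS](measureDI (Pr mu) _ mF)// [X in (X + _)%E](_ : _ = 0%E).
  by rewrite add0e setIC.
apply: (subset_measure0 _ _ _ (measure_negligible (measurableC mF) aeT)) => //.
- exact: measurableD.
- exact: measurableC.
Qed.

End transport.

Theorem theorem2p1 (R : realType) (S : finType) (p : S -> distr R S)
    (d : measure_display) (Omega : measurableType d)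
    (Pr : distr R S -> probability Omega R)
    (X : nat -> Omega -> S) (U : Omega -> R)
    (chainX : forall lambda : distr R S, markov_chain p lambda (Pr lambda) X)
    (unifU : forall lambda : distr R S, uniform_independent (Pr lambda) U X)
    (irrX : irreducible_chain p)
    (mu nu : distr R S) :
  (optimal_transport_time Pr U X mu nu <=
   \big[maxe/-oo]_(i : S) \big[maxe/-oo]_(j : S) mean_hitting_time Pr X i j)%E.
Proof.
set M := \big[maxe/-oo%E]_(i : S) _.
have leM i j : (mean_hitting_time Pr X i j <= M)%E.
  apply: le_trans (le_bigmax _ _ i).
  exact: (le_bigmax _ (fun j => mean_hitting_time Pr X i j)).
have [B [mB tB nuB]] := uniform_partition nu.
pose T := randomized_hitting_time X U B.
have ET : (\int[Pr mu]_w T w <= M)%E.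
  rewrite (mean_randomized_hitting_time chainX unifU mu mB tB nuB).
  have c0 i j : 0 <= nu j * mu i by rewrite mulr_ge0// Defs.pmf_ge0.
  have -> : M = (\sum_j \sum_i (nu j * mu i)%:E * M)%E.
    (* The weights [nu j * mu i] sum to 1. *)
    have rowM j : (\sum_i (nu j * mu i)%:E * M = (nu j)%:E * M)%E.
      rewrite -ge0_sume_distrl => [|i _]; last by rewrite lee_fin.
      by rewrite sumEFin -mulr_sumr pmf_sum1 mulr1.
    rewrite (eq_bigr _ (fun j _ => rowM j)) -ge0_sume_distrl => [|j _].
      by rewrite sumEFin pmf_sum1 mul1e.
    by rewrite lee_fin Defs.pmf_ge0.
  by do 2 apply: lee_sum => ? _; apply: lee_wpmul2l; rewrite ?lee_fin.
have [->|My] := eqVneq M +oo%E; first exact: leey.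
have [|aeT lawT] := @stopped_law_randomized_hitting_time _ _ _ _ _ _ _ _
    chainX unifU _ mu _ mB tB nuB.
  by apply: le_lt_trans ET _; rewrite ltey.
apply: le_trans ET; apply: ereal_inf_lbound; exists T => //; split=> //.
exact: randomized_hitting_time_stopping.
Qed.
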